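(* Let $n,p\ge 1$ be integers, let $X\in\mathbb{R}^{n\times p}$ be a real matrix, let $\Omega\in\mathbb{R}^{p\times p}$ be an invertible (hence symmetric positive definite) correlation matrix, and let $D_\lambda\in\mathbb{R}^{p\times p}$ be the diagonal matrix whose diagonal entries are positive scales (the local scales). Define $$Q_\Omega = X'X + D_\lambda^{-1}\Omega^{-1}D_\lambda^{-1},\qquad Q_I = X'X + D_\lambda^{-2}.$$ Let $\lambda_1$ and $\lambda_p$ denote the largest and smallest diagonal entries of $D_\lambda$, let $\omega_1$ and $\omega_p$ denote the largest and smallest eigenvalues of $\Omega$, and let $\nu_1$ and $\nu_p$ denote the largest and smallest eigenvalues of $X'X$. Then $$\frac{\| \Omega^{-1} - I \|_2}{\lambda_1^2 \left( \nu_1 + \frac{1}{\lambda_p^2 \omega_p} \right)\left( \nu_1 + \frac{1}{\lambda_p^2} \right)} \;\leq\; \| Q_\Omega^{-1} - Q_I^{-1} \|_2 \;\leq\; \frac{ \| \Omega^{-1} - I \|_2}{\lambda_p^2 \left( \nu_p + \frac{1}{\lambda_1^2 \omega_1} \right)\left( \nu_p + \frac{1}{\lambda_1^2} \right)}.$$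
   Context: $X'$ denotes the transpose of $X$, $I$ is the $p\times p$ identity matrix, and $\|A\|_2$ is the spectral norm of a matrix $A$, i.e. its largest singular value. A correlation matrix is a real symmetric positive semidefinite matrix with all diagonal entries equal to $1$. For background: in the linear regression model with prior $b\mid\sigma,\tau,\lambda\sim\mathcal{N}(0,\sigma^2\tau^2 D_\lambda\Omega D_\lambda)$, where $\tau>0$ is a global scale, the matrix $\sigma^2 Q_\Omega^{-1}$ with $Q_\Omega = X'X+\tau^{-2}D_\lambda^{-1}\Omega^{-1}D_\lambda^{-1}$ is the conditional posterior covariance of the coefficient vector $b$; the statement is for the normalization $\tau^2=1$. The matrix $Q_I$ is $Q_\Omega$ with $\Omega=I$. *)

(* Defs.v *)
From HB Require Import structures.
From mathcomp Require Import all_boot all_order all_algebra.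
From mathcomp Require Import boolp classical_sets reals.

Set Implicit Arguments.
Unset Strict Implicit.
Unset Printing Implicit Defensive.

Import Order.TTheory GRing.Theory Num.Theory.
Local Open Scope classical_set_scope.
Local Open Scope ring_scope.

(* The greatest (least) element of S, which must belong to S. The default 0 is
   returned only when S has no such element; this never happens for a nonempty
   finite S. *)
Definition max_elt (R : realType) (S : set R) : R :=
  xget 0 (S `&` ubound S).

Definition min_elt (R : realType) (S : set R) : R :=
  xget 0 (S `&` lbound S).

Lemma max_eltE (R : realType) (S : set R) (m : R) :
  S m -> ubound S m -> max_elt S = m.
Proof.
move=> Sm Um; apply: xget_unique => // y [Sy Uy].
by apply/le_anti; rewrite Um //= Uy.
Qed.

Lemma min_eltE (R : realType) (S : set R) (m : R) :
  S m -> lbound S m -> min_elt S = m.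
Proof.
move=> Sm Lm; apply: xget_unique => // y [Sy Ly].
by apply/le_anti; rewrite Ly //= Lm.
Qed.

Definition eigenvalues (R : realType) (p : nat) (A : 'M[R]_p) : set R :=
  [set a | eigenvalue A a].

Definition diag_entries (R : realType) (p : nat) (A : 'M[R]_p) : set R :=
  range (fun i : 'I_p => A i i).

(* Singular values of A: the nonnegative square roots of the eigenvalues of
   A^T A. For a wide A (m < n) this adds at most the value 0 to the usual list
   of min(m, n) singular values, and so never changes the largest one. *)
Definition singular_values (R : realType) (m n : nat) (A : 'M[R]_(m, n)) :
  set R := [set s | 0 <= s /\ eigenvalue (A^T *m A) (s ^+ 2)].

Definition spectral_norm (R : realType) (m n : nat) (A : 'M[R]_(m, n)) : R :=
  max_elt (singular_values A).

Definition psd (R : realType) (p : nat) (A : 'M[R]_p) : Prop :=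
  forall x : 'cV[R]_p, 0 <= (x^T *m A *m x) 0 0.

Definition correlation_matrix (R : realType) (p : nat) (A : 'M[R]_p) : Prop :=
  [/\ A \is symmetricmx, psd A & forall i, A i i = 1].

Definition Qcorr (R : realType) (n p : nat) (X : 'M[R]_(n, p))
    (Omega D : 'M[R]_p) : 'M[R]_p :=
  X^T *m X + invmx D *m invmx Omega *m invmx D.

Definition Qind (R : realType) (n p : nat) (X : 'M[R]_(n, p))
    (D : 'M[R]_p) : 'M[R]_p :=
  X^T *m X + invmx D *m invmx D.

(* Main.v *)
(* With E = Omega^-1 - I and Delta = Q_Omega^-1 - Q_I^-1, the resolvent identity
   gives Delta = - Q_Omega^-1 D^-1 E D^-1 Q_I^-1, equivalently
   E = - D Q_Omega Delta Q_I D. Both bounds follow by submultiplicativity of the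
   operator norm, after bounding the quadratic forms of Q_Omega and Q_I above
   and below. The spectral norm is the operator norm because the largest
   eigenvalue of a real symmetric matrix A is the infimum a of the c such that
   <x, A x> <= c |x|^2: if a - A were invertible, it would be coercive, and the
   infimum could be lowered. *)
Require Import Defs.
From mathcomp Require Import all_boot all_order all_algebra.
From mathcomp Require Import boolp classical_sets reals.
From mathcomp Require Import ring lra.

Set Implicit Arguments.
Unset Strict Implicit.

Import Order.TTheory GRing.Theory Num.Theory.
Local Open Scope ring_scope.

(** * Euclidean inner product and squared norm *)

Definition dot (R : realType) (n : nat) (x y : 'cV[R]_n) : R := (x^T *m y) 0 0.

Definition sqnorm (R : realType) (n : nat) (x : 'cV[R]_n) : R := dot x x.

(* The operator norm of A is at most |c|. *)
Definition op_le (R : realType) (m n : nat) (A : 'M[R]_(m, n)) (c : R) : Prop :=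
  forall x, sqnorm (A *m x) <= c ^+ 2 * sqnorm x.

Section QuadraticForms.
Context {R : realType}.

Lemma dotE n (x y : 'cV[R]_n) : dot x y = \sum_i x i 0 * y i 0.
Proof. by rewrite /dot mxE; apply: eq_bigr => i _; rewrite mxE. Qed.

Lemma dotC n (x y : 'cV[R]_n) : dot x y = dot y x.
Proof. by rewrite !dotE; apply: eq_bigr => i _; rewrite mulrC. Qed.

Lemma dotDl n (x y z : 'cV[R]_n) : dot (x + y) z = dot x z + dot y z.
Proof. by rewrite /dot linearD /= mulmxDl mxE. Qed.

Lemma dotDr n (x y z : 'cV[R]_n) : dot x (y + z) = dot x y + dot x z.
Proof. by rewrite dotC dotDl !(dotC x). Qed.

Lemma dotZl n a (x y : 'cV[R]_n) : dot (a *: x) y = a * dot x y.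
Proof. by rewrite /dot linearZ /= -scalemxAl mxE. Qed.

Lemma dotZr n a (x y : 'cV[R]_n) : dot x (a *: y) = a * dot x y.
Proof. by rewrite dotC dotZl dotC. Qed.

Lemma dotNr n (x y : 'cV[R]_n) : dot x (- y) = - dot x y.
Proof. by rewrite -scaleN1r dotZr mulN1r. Qed.

Lemma dot_mulmx m n (A : 'M[R]_(m, n)) (x : 'cV[R]_m) (y : 'cV[R]_n) :
  dot x (A *m y) = dot (A^T *m x) y.
Proof. by rewrite /dot trmx_mul trmxK mulmxA. Qed.

Lemma sqnormE n (x : 'cV[R]_n) : sqnorm x = \sum_i x i 0 ^+ 2.
Proof. by rewrite /sqnorm dotE. Qed.

Lemma sqnorm_ge0 n (x : 'cV[R]_n) : 0 <= sqnorm x.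
Proof. by rewrite sqnormE sumr_ge0 // => i _; exact: sqr_ge0. Qed.

Lemma sqnorm_eq0 n (x : 'cV[R]_n) : (sqnorm x == 0) = (x == 0).
Proof.
apply/idP/eqP => [|->]; last by rewrite sqnormE big1 // => i _; rewrite mxE expr0n.
rewrite sqnormE psumr_eq0 => [/allP x0|i _]; last exact: sqr_ge0.
apply/colP => i; rewrite mxE; apply/eqP; rewrite -sqrf_eq0.
by have /implyP := x0 i (mem_index_enum i); apply.
Qed.

Lemma sqnorm_gt0 n (x : 'cV[R]_n) : (0 < sqnorm x) = (x != 0).
Proof. by rewrite lt_neqAle sqnorm_ge0 andbT eq_sym sqnorm_eq0. Qed.

Lemma sqnormZ n a (x : 'cV[R]_n) : sqnorm (a *: x) = a ^+ 2 * sqnorm x.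
Proof. by rewrite /sqnorm dotZl dotZr mulrA. Qed.

Lemma sqnorm0 n : sqnorm (0 : 'cV[R]_n) = 0.
Proof. by apply/eqP; rewrite sqnorm_eq0. Qed.

Lemma sqnormB n (x y : 'cV[R]_n) :
  sqnorm (x - y) = sqnorm x - 2 * dot x y + sqnorm y.
Proof.
rewrite /sqnorm -scaleN1r !(dotDl, dotDr, dotZl, dotZr) (dotC y x); ring.
Qed.

Lemma sqnorm_mulmx m n (A : 'M[R]_(m, n)) x :
  sqnorm (A *m x) = dot x (A^T *m A *m x).
Proof. by rewrite -mulmxA [RHS]dot_mulmx trmxK. Qed.

(** * Cauchy-Schwarz inequalities and bounds on quadratic forms *)

Lemma psd_cauchy_schwarz n (A : 'M[R]_n) (x y : 'cV[R]_n) :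
    A^T = A -> (forall z, 0 <= dot z (A *m z)) ->
  dot x (A *m y) ^+ 2 <= dot x (A *m x) * dot y (A *m y).
Proof.
move=> symA A_ge0.
set a := dot x (A *m x); set b := dot x (A *m y); set c := dot y (A *m y).
(* The form at [c *: x - b *: y] gives the inequality multiplied by c; when c = 0,
   a large negative multiple of y forces b = 0. *)
have q s t : 0 <= s ^+ 2 * a + 2 * s * t * b + t ^+ 2 * c.
  have := A_ge0 (s *: x + t *: y).
  rewrite mulmxDr -!scalemxAr !(dotDl, dotDr, dotZl, dotZr).
  rewrite (dot_mulmx A y) symA (dotC (A *m y)) -/a -/b -/c.
  by congr (_ <= _); ring.
have a_ge0 : 0 <= a by exact: A_ge0.
have [c0|c0] := eqVneq c 0; last first.
  have c_gt0 : 0 < c by rewrite lt_neqAle eq_sym c0 A_ge0.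
  rewrite -subr_ge0 -(pmulr_rge0 _ c_gt0).
  by have := q c (- b); congr (_ <= _); ring.
have := q b (- (a + 1)); rewrite c0 !mulr0 addr0 => h.
have {}h : 0 <= - (b ^+ 2 * (a + 2)).
  by move: h; congr (_ <= _); ring.
move: h; rewrite oppr_ge0 pmulr_lle0 //.
by apply: ltr_wpDl.
Qed.

Lemma cauchy_schwarz n (x y : 'cV[R]_n) : dot x y ^+ 2 <= sqnorm x * sqnorm y.
Proof.
have := @psd_cauchy_schwarz n 1%:M x y; rewrite trmx1 !mul1mx; apply => // z.
by rewrite mul1mx sqnorm_ge0.
Qed.

(** Cauchy-Schwarz for the form of [A] at [x] and [A *m x] gives |Ax|^4 <= <x, Ax> <Ax, AAx> <= <x,
    Ax> c |Ax|^2; then |Ax|^2 cancels. This is A^2 <= c A, obtained without diagonalizing [A]. *)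
Lemma psd_sqnorm_mulmx_le n (A : 'M[R]_n) c x :
    A^T = A -> (forall z, 0 <= dot z (A *m z)) ->
    (forall z, dot z (A *m z) <= c * sqnorm z) ->
  sqnorm (A *m x) <= c * dot x (A *m x).
Proof.
move=> symA A_ge0 A_le.
have [->|Ax0] := eqVneq (A *m x) 0.
  by rewrite sqnorm0 /dot mulmx0 mxE mulr0.
have s_gt0 : 0 < sqnorm (A *m x) by rewrite sqnorm_gt0.
have := psd_cauchy_schwarz x (A *m x) symA A_ge0.
rewrite dot_mulmx symA -/(sqnorm _) => h.
rewrite -(ler_pM2r s_gt0) -expr2; apply: le_trans h _.
by rewrite mulrAC mulrC ler_wpM2r.
Qed.

Lemma sqnorm_mulmx_bounded m n (A : 'M[R]_(m, n)) :
  exists2 c, 0 <= c & forall x, sqnorm (A *m x) <= c * sqnorm x.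
Proof.
(* The squared Frobenius norm; Cauchy-Schwarz is applied to each row. *)
exists (\sum_i sqnorm (row i A)^T).
  by rewrite sumr_ge0 // => i _; exact: sqnorm_ge0.
move=> x; rewrite sqnormE mulr_suml; apply: ler_sum => i _.
apply: le_trans (cauchy_schwarz _ _).
by rewrite /dot trmxK -row_mul [X in _ <= X ^+ 2]mxE.
Qed.

Lemma quadratic_form_bounded n (A : 'M[R]_n) :
  exists2 c, 0 <= c & forall x, dot x (A *m x) <= c * sqnorm x.
Proof.
have [c c0 cA] := sqnorm_mulmx_bounded A.
exists (1 + c) => [|x]; first by rewrite addr_ge0.
(* Expanding 0 <= |x - Ax|^2 gives 2 <x, Ax> <= |x|^2 + |Ax|^2. *)
have := sqnorm_ge0 (x - A *m x); have := cA x; have := sqnorm_ge0 x.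
have := sqnorm_ge0 (A *m x).
rewrite sqnormB; lra.
Qed.

Lemma unitmx_lower_bound n (A : 'M[R]_n) c :
  0 < c -> (forall x, c * sqnorm x <= sqnorm (A *m x)) -> A \in unitmx.
Proof.
move=> c_gt0 cA; rewrite -unitmx_tr -row_free_unit -kermx_eq0.
apply/rowV0P => v /sub_kermxP vA.
have := cA v^T; rewrite -[A]trmxK -trmx_mul vA trmx0 sqnorm0.
rewrite pmulr_rle0 // => s0; apply/eqP; rewrite -trmx_eq0 -sqnorm_eq0.
by rewrite eq_le s0 sqnorm_ge0.
Qed.

(** * Extreme eigenvalues of symmetric matrices *)

Lemma eigenvalue_colP n (A : 'M[R]_n) a : A^T = A ->
  eigenvalue A a <-> exists2 x : 'cV[R]_n, A *m x = a *: x & x != 0.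
Proof.
move=> symA; split=> [/eigenvalueP[v vA v0]|[x xA x0]].
  by exists v^T; rewrite ?trmx_eq0 // -{1}symA -trmx_mul vA linearZ.
by apply/eigenvalueP; exists x^T; rewrite ?trmx_eq0 // -{1}symA -trmx_mul xA linearZ.
Qed.

Lemma symmetric_top_eigenvalue n (A : 'M[R]_n) : (0 < n)%N -> A^T = A ->
  exists2 a, eigenvalue A a & forall x, dot x (A *m x) <= a * sqnorm x.
Proof.
case: n A => // n A _ symA.
pose S : set R := [set c | forall x, dot x (A *m x) <= c * sqnorm x]%classic.
(* Since the dimension is positive, a nonzero vector exists; its Rayleigh quotient is a lower bound
   of [S]. *)
pose e : 'cV[R]_n.+1 := delta_mx 0 0.
have e_gt0 : 0 < sqnorm e.
  rewrite sqnorm_gt0; apply/eqP => /matrixP/(_ 0 0).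
  by rewrite !mxE eqxx => /eqP; rewrite oner_eq0.
have S0 : (S !=set0)%classic.
  by have [c _ cS] := quadratic_form_bounded A; exists c.
have S_lb x : 0 < sqnorm x -> lbound S (dot x (A *m x) / sqnorm x).
  by move=> x0 c /(_ x); rewrite ler_pdivrMr.
have hasS : has_lbound S by exists (dot e (A *m e) / sqnorm e); exact: S_lb.
pose a := inf S.
have aS x : dot x (A *m x) <= a * sqnorm x.
  have [->|x0] := eqVneq x 0.
    by rewrite mulmx0 -/(sqnorm _) sqnorm0 mulr0.
  have s0 : 0 < sqnorm x by rewrite sqnorm_gt0.
  by rewrite -ler_pdivrMr //; apply: lb_le_inf => //; exact: S_lb.
exists a => //; rewrite /eigenvalue /eigenspace kermx_eq0 row_free_unit; apply/negP => uA.
pose M := a%:M - A.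
have uM : M \in unitmx by rewrite /M -opprB -scaleN1r unitmxZ ?unitrN1.
have symM : M^T = M by rewrite /M linearB /= tr_scalar_mx symA.
have ME x : dot x (M *m x) = a * sqnorm x - dot x (A *m x).
  by rewrite /M mulmxBl dotDr dotNr mul_scalar_mx dotZr.
have M_ge0 x : 0 <= dot x (M *m x) by rewrite ME subr_ge0.
have [c c_ge0 cM] := quadratic_form_bounded M.
have [d d_ge0 dM] := sqnorm_mulmx_bounded (invmx M).
(* Coercivity of M = a - A: |x|^2 = |M^-1 M x|^2 <= d |Mx|^2 <= d c <x, Mx>. Adding 1 makes the
   constant invertible even when d c = 0. *)
have key x : sqnorm x <= (d * c + 1) * dot x (M *m x).
  have := dM (M *m x); rewrite mulKmx // => /le_trans; apply.
  rewrite mulrDl mul1r; apply: ler_wpDr => //.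
  by rewrite -mulrA ler_wpM2l // psd_sqnorm_mulmx_le.
have k_gt0 : 0 < d * c + 1 by rewrite ltr_wpDl ?mulr_ge0.
(* Coercivity leaves room to lower [a] within [S], contradicting that it is the infimum. *)
have : a - (d * c + 1)^-1 \in S.
  rewrite inE => x; have := key x; rewrite -ler_pdivrMl // ME mulrBl; lra.
rewrite inE => /(ge_inf hasS); rewrite -/a.
by have : 0 < (d * c + 1)^-1; [rewrite invr_gt0 | lra].
Qed.

Lemma max_eigenvalueP n (A : 'M[R]_n) : (0 < n)%N -> A^T = A ->
  eigenvalue A (max_elt (eigenvalues A)) /\
  forall x, dot x (A *m x) <= max_elt (eigenvalues A) * sqnorm x.
Proof.
move=> n_gt0 symA; have [a aA a_ub] := symmetric_top_eigenvalue n_gt0 symA.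
suff -> : max_elt (eigenvalues A) = a by [].
apply: max_eltE => // b /eigenvalue_colP-/(_ symA)[x xA x0].
have s_gt0 : 0 < sqnorm x by rewrite sqnorm_gt0.
by have := a_ub x; rewrite xA dotZr ler_pM2r.
Qed.

(** The least eigenvalue of [A] is minus the greatest eigenvalue of [- A]. *)
Lemma min_eigenvalueP n (A : 'M[R]_n) : (0 < n)%N -> A^T = A ->
  eigenvalue A (min_elt (eigenvalues A)) /\
  forall x, min_elt (eigenvalues A) * sqnorm x <= dot x (A *m x).
Proof.
move=> n_gt0 symA.
have symNA : (- A)^T = - A by rewrite linearN /= symA.
have [a /eigenvalue_colP-/(_ symNA)[y yA y0] a_ub] :=
  symmetric_top_eigenvalue n_gt0 symNA.
have lb x : - a * sqnorm x <= dot x (A *m x).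
  by have := a_ub x; rewrite mulNmx dotNr mulNr lerNl.
suff -> : min_elt (eigenvalues A) = - a.
  split => //; apply/eigenvalue_colP => //; exists y => //.
  by rewrite scaleNr -yA mulNmx opprK.
apply: min_eltE.
  apply/eigenvalue_colP => //; exists y => //.
  by rewrite scaleNr -yA mulNmx opprK.
move=> b /eigenvalue_colP-/(_ symA)[x xA x0].
have s_gt0 : 0 < sqnorm x by rewrite sqnorm_gt0.
by have := lb x; rewrite xA dotZr ler_pM2r.
Qed.

(** * The spectral norm as the least operator norm bound *)

Lemma spectral_normP m n (A : 'M[R]_(m, n)) : (0 < n)%N ->
  [/\ 0 <= spectral_norm A, op_le A (spectral_norm A) &
      forall c, 0 <= c -> op_le A c -> spectral_norm A <= c].
Proof.
move=> n_gt0.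
have symG : (A^T *m A)^T = A^T *m A by rewrite trmx_mul trmxK.
have [a aG a_ub] := symmetric_top_eigenvalue n_gt0 symG.
have [x xG x0] := (eigenvalue_colP _ symG).1 aG.
have s_gt0 : 0 < sqnorm x by rewrite sqnorm_gt0.
have xE : sqnorm (A *m x) = a * sqnorm x by rewrite sqnorm_mulmx xG dotZr.
have a_ge0 : 0 <= a by rewrite -(pmulr_lge0 _ s_gt0) -xE sqnorm_ge0.
(* Squares of singular values are eigenvalues of A^T A, so the largest one is the square root of the
   top eigenvalue [a]. The bound is attained at the eigenvector [x], hence no smaller constant
   works. *)
have -> : spectral_norm A = Num.sqrt a.
  apply: max_eltE => [|b [b0 bG]]; first by split; rewrite ?sqr_sqrtr ?sqrtr_ge0.
  have [y yG y0] := (eigenvalue_colP _ symG).1 bG.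
  have t_gt0 : 0 < sqnorm y by rewrite sqnorm_gt0.
  rewrite -(ger0_norm b0) -sqrtr_sqr ler_wsqrtr //.
  by have := a_ub y; rewrite yG dotZr ler_pM2r.
split=> [|y|c c0 /(_ x)]; first exact: sqrtr_ge0.
  by rewrite sqr_sqrtr // sqnorm_mulmx.
by rewrite xE ler_pM2r // => ac; rewrite -(ger0_norm c0) -sqrtr_sqr ler_wsqrtr.
Qed.

(** * Operator norm bounds for products, forms and inverses *)

Lemma op_le_mulmx m n k (A : 'M[R]_(m, n)) (B : 'M[R]_(n, k)) c d :
  op_le A c -> op_le B d -> op_le (A *m B) (c * d).
Proof.
move=> cA dB x; rewrite -mulmxA; apply: le_trans (cA _) _.
by rewrite exprMn -[leRHS]mulrA ler_wpM2l ?sqr_ge0.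
Qed.

Lemma op_leN m n (A : 'M[R]_(m, n)) c : op_le A c -> op_le (- A) c.
Proof. by move=> cA x; rewrite mulNmx -scaleN1r sqnormZ sqrrN expr1n mul1r. Qed.

Lemma psd_op_le n (A : 'M[R]_n) c :
    A^T = A -> 0 <= c -> (forall x, 0 <= dot x (A *m x)) ->
    (forall x, dot x (A *m x) <= c * sqnorm x) ->
  op_le A c.
Proof.
move=> symA c_ge0 A_ge0 A_le x.
apply: le_trans (psd_sqnorm_mulmx_le _ symA A_ge0 A_le) _.
by rewrite expr2 -mulrA ler_wpM2l.
Qed.

(** By Cauchy-Schwarz c |x|^2 <= <x, Ax> <= |x| |Ax|; a factor |x| cancels. *)
Lemma coercive_lower_bound n (A : 'M[R]_n) c x :
    0 < c -> c * sqnorm x <= dot x (A *m x) ->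
  c ^+ 2 * sqnorm x <= sqnorm (A *m x).
Proof.
move=> c_gt0 cA.
have [->|x0] := eqVneq x 0.
  by rewrite sqnorm0 mulr0 sqnorm_ge0.
have s_gt0 : 0 < sqnorm x by rewrite sqnorm_gt0.
rewrite -(ler_pM2l s_gt0); apply: le_trans (cauchy_schwarz _ _).
rewrite mulrCA -expr2 -exprMn ler_sqr // nnegrE; first by rewrite mulr_ge0 // ltW.
by apply: le_trans cA; rewrite mulr_ge0 // ltW.
Qed.

Lemma op_le_invmx n (A : 'M[R]_n) c :
    0 < c -> (forall x, c ^+ 2 * sqnorm x <= sqnorm (A *m x)) ->
  op_le (invmx A) c^-1.
Proof.
move=> c_gt0 cA x.
have uA : A \in unitmx by apply: unitmx_lower_bound cA; rewrite exprn_gt0.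
rewrite exprVn -ler_pdivrMl ?invr_gt0 ?exprn_gt0 // invrK.
by have := cA (invmx A *m x); rewrite mulKVmx.
Qed.

End QuadraticForms.

(** * Diagonal scales and the quadratic form of the posterior precision *)

Section PosteriorPrecision.
Context {R : realType}.

Lemma max_diag_entriesP p (d : 'rV[R]_p) : (0 < p)%N ->
  (exists i, max_elt (diag_entries (diag_mx d)) = d 0 i) /\
  forall i, d 0 i <= max_elt (diag_entries (diag_mx d)).
Proof.
case: p d => // p d _.
case: (arg_maxP (fun i => d 0 i) (erefl (predT (ord0 : 'I_p.+1)))) => i _ i_max.
have -> : max_elt (diag_entries (diag_mx d)) = d 0 i.
  apply: max_eltE => [|_ [j _ <-]]; first by exists i; rewrite // mxE eqxx.
  by rewrite mxE eqxx; exact: i_max.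
by split=> [|j]; [exists i | exact: i_max].
Qed.

Lemma min_diag_entriesP p (d : 'rV[R]_p) : (0 < p)%N ->
  (exists i, min_elt (diag_entries (diag_mx d)) = d 0 i) /\
  forall i, min_elt (diag_entries (diag_mx d)) <= d 0 i.
Proof.
case: p d => // p d _.
case: (arg_minP (fun i => d 0 i) (erefl (predT (ord0 : 'I_p.+1)))) => i _ i_min.
have -> : min_elt (diag_entries (diag_mx d)) = d 0 i.
  apply: min_eltE => [|_ [j _ <-]]; first by exists i; rewrite // mxE eqxx.
  by rewrite mxE eqxx; exact: i_min.
by split=> [|j]; [exists i | exact: i_min].
Qed.

Lemma sqnorm_diag_mx p (d : 'rV[R]_p) (x : 'cV[R]_p) :
  sqnorm (diag_mx d *m x) = \sum_i d 0 i ^+ 2 * x i 0 ^+ 2.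
Proof.
by rewrite sqnormE; apply: eq_bigr => i _; rewrite mul_diag_mx mxE exprMn.
Qed.

(** With x = A y and f = <y, Ay>, the claim becomes w f <= |Ay|^2. Cauchy-Schwarz and coercivity
    give w f^2 <= w |y|^2 |Ay|^2 <= f |Ay|^2, and f cancels unless it is 0. *)
Lemma dot_invmx_le n (A : 'M[R]_n) (w : R) (x : 'cV[R]_n) :
    A^T = A -> 0 < w -> (forall y, w * sqnorm y <= dot y (A *m y)) ->
  dot x (invmx A *m x) <= w^-1 * sqnorm x.
Proof.
move=> symA w_gt0 wA.
have uA : A \in unitmx.
  apply: (@unitmx_lower_bound _ _ _ (w ^+ 2)); first by rewrite exprn_gt0.
  by move=> y; apply: coercive_lower_bound.
set y := invmx A *m x; have -> : x = A *m y by rewrite mulKVmx.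
rewrite -{1}symA -dot_mulmx ler_pdivlMl //.
set f := dot y _.
have f_ge0 : 0 <= f by apply: le_trans (wA y); rewrite mulr_ge0 ?sqnorm_ge0 ?ltW.
have [->|f0] := eqVneq f 0; first by rewrite mulr0 sqnorm_ge0.
have f_gt0 : 0 < f by rewrite lt_neqAle eq_sym f0.
rewrite -(ler_pM2r f_gt0) -mulrA -expr2.
apply: le_trans (_ : w * (sqnorm y * sqnorm (A *m y)) <= _).
  by rewrite ler_pM2l // cauchy_schwarz.
by rewrite mulrA mulrC ler_wpM2l ?sqnorm_ge0.
Qed.

(** With x = A y this is |Ay|^2 <= w <y, Ay>, the inequality A^2 <= w A. *)
Lemma dot_invmx_ge n (A : 'M[R]_n) (w : R) (x : 'cV[R]_n) :
    A^T = A -> A \in unitmx -> 0 < w -> (forall y, 0 <= dot y (A *m y)) ->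
    (forall y, dot y (A *m y) <= w * sqnorm y) ->
  w^-1 * sqnorm x <= dot x (invmx A *m x).
Proof.
move=> symA uA w_gt0 A_ge0 wA.
set y := invmx A *m x; have -> : x = A *m y by rewrite mulKVmx.
rewrite -{2}symA -dot_mulmx ler_pdivrMl //.
exact: psd_sqnorm_mulmx_le.
Qed.

Lemma Qcorr_tr n p (X : 'M[R]_(n, p)) (Omega D : 'M[R]_p) :
  Omega^T = Omega -> D^T = D -> (Qcorr X Omega D)^T = Qcorr X Omega D.
Proof.
move=> symO symD.
by rewrite /Qcorr linearD /= !trmx_mul trmxK !trmx_inv symO symD mulmxA.
Qed.

Lemma Qcorr1 n p (X : 'M[R]_(n, p)) (D : 'M[R]_p) : Qcorr X 1%:M D = Qind X D.
Proof. by rewrite /Qcorr invmx1 mulmx1. Qed.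

Lemma sqnorm_invmx_bounds p (D : 'M[R]_p) (l L : R) (x : 'cV[R]_p) :
    0 < l -> 0 < L -> (forall y, l ^+ 2 * sqnorm y <= sqnorm (D *m y)) ->
    op_le D L ->
  L ^- 2 * sqnorm x <= sqnorm (invmx D *m x) <= l ^- 2 * sqnorm x.
Proof.
move=> l_gt0 L_gt0 lD LD.
have uD : D \in unitmx by apply: unitmx_lower_bound lD; rewrite exprn_gt0.
rewrite ler_pdivrMl ?exprn_gt0 // -exprVn (op_le_invmx l_gt0 lD) andbT.
by have := LD (invmx D *m x); rewrite mulKVmx.
Qed.

(** With z = D^-1 x the form splits as <x, X'X x> + <z, Omega^-1 z>. The last term lies between
    |z|^2 / W and |z|^2 / w, and |z|^2 between |x|^2 / L^2 and |x|^2 / l^2. *)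
Lemma Qcorr_form_bounds n p (X : 'M[R]_(n, p)) (Omega D : 'M[R]_p)
    (l L w W u v : R) :
    0 < l -> 0 < L -> 0 < w -> 0 < W ->
    Omega^T = Omega -> D^T = D ->
    (forall y, l ^+ 2 * sqnorm y <= sqnorm (D *m y)) -> op_le D L ->
    (forall y, w * sqnorm y <= dot y (Omega *m y) <= W * sqnorm y) ->
    (forall y, u * sqnorm y <= dot y (X^T *m X *m y) <= v * sqnorm y) ->
  forall x, (u + 1 / (L ^+ 2 * W)) * sqnorm x <= dot x (Qcorr X Omega D *m x)
            <= (v + 1 / (l ^+ 2 * w)) * sqnorm x.
Proof.
move=> l_gt0 L_gt0 w_gt0 W_gt0 symO symD lD LD OwW Xuv x.
have Ow y : w * sqnorm y <= dot y (Omega *m y) by case/andP: (OwW y).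
have OW y : dot y (Omega *m y) <= W * sqnorm y by case/andP: (OwW y).
have uO : Omega \in unitmx.
  apply: (@unitmx_lower_bound _ _ _ (w ^+ 2)); first by rewrite exprn_gt0.
  by move=> y; apply: coercive_lower_bound.
have O_ge0 y : 0 <= dot y (Omega *m y).
  by apply: le_trans (Ow y); rewrite mulr_ge0 ?sqnorm_ge0 ?ltW.
set z := invmx D *m x.
have -> : dot x (Qcorr X Omega D *m x) =
    dot x (X^T *m X *m x) + dot z (invmx Omega *m z).
  by rewrite /Qcorr mulmxDl dotDr -!mulmxA [in X in _ + X]dot_mulmx trmx_inv symD.
have /andP[zL zl] := sqnorm_invmx_bounds x l_gt0 L_gt0 lD LD.
have /andP[ux vx] := Xuv x.
rewrite !mulrDl !div1r (invfM _ W) (invfM _ w); apply/andP; split; apply: lerD => //.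
  apply: le_trans (dot_invmx_ge z symO uO W_gt0 O_ge0 OW).
  by rewrite [_ * W^-1]mulrC -mulrA ler_pM2l // invr_gt0.
apply: le_trans (dot_invmx_le z symO w_gt0 Ow) _.
by rewrite [_ * w^-1]mulrC -mulrA ler_pM2l // invr_gt0.
Qed.

Lemma coercive_op_le_invmx n (A : 'M[R]_n) c :
    0 < c -> (forall x, c * sqnorm x <= dot x (A *m x)) ->
  A \in unitmx /\ op_le (invmx A) c^-1.
Proof.
move=> c_gt0 cA.
have lb x : c ^+ 2 * sqnorm x <= sqnorm (A *m x) by apply: coercive_lower_bound.
split; last exact: op_le_invmx.
by apply: unitmx_lower_bound lb; rewrite exprn_gt0.
Qed.

Lemma Qcorr_sub_Qind n p (X : 'M[R]_(n, p)) (Omega D : 'M[R]_p) :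
  Qcorr X Omega D - Qind X D = invmx D *m (invmx Omega - 1%:M) *m invmx D.
Proof.
by rewrite /Qcorr /Qind opprD addrACA subrr add0r mulmxBr mulmx1 mulmxBl.
Qed.

End PosteriorPrecision.

(** * The resolvent identity and the two-sided bound *)

Lemma invmx_sub (R : comUnitRingType) n (A B : 'M[R]_n) :
    A \in unitmx -> B \in unitmx ->
  invmx A - invmx B = - (invmx A *m (A - B) *m invmx B).
Proof.
by move=> uA uB; rewrite mulmxBr mulmxBl mulVmx // mul1mx mulmxK // opprB.
Qed.

Unset Implicit Arguments.

Theorem mainTheorem1 (R : realType) (n p : nat) (n_ge1 : (1 <= n)%N)
    (p_ge1 : (1 <= p)%N) (X : 'M[R]_(n, p)) (Omega : 'M[R]_p)
    (Omega_corr : correlation_matrix Omega) (Omega_unit : Omega \in unitmx)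
    (lambda : 'rV[R]_p) (lambda_gt0 : forall i, 0 < lambda 0 i) :
  let D := diag_mx lambda in
  let QOmega := Qcorr X Omega D in
  let QI := Qind X D in
  let lambda1 := max_elt (diag_entries D) in
  let lambdap := min_elt (diag_entries D) in
  let omega1 := max_elt (eigenvalues Omega) in
  let omegap := min_elt (eigenvalues Omega) in
  let nu1 := max_elt (eigenvalues (X^T *m X)) in
  let nup := min_elt (eigenvalues (X^T *m X)) in
  spectral_norm (invmx Omega - 1%:M) /
      (lambda1 ^+ 2 * (nu1 + 1 / (lambdap ^+ 2 * omegap))
                    * (nu1 + 1 / lambdap ^+ 2))
    <= spectral_norm (invmx QOmega - invmx QI)
  /\
  spectral_norm (invmx QOmega - invmx QI)
    <= spectral_norm (invmx Omega - 1%:M) /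
      (lambdap ^+ 2 * (nup + 1 / (lambda1 ^+ 2 * omega1))
                    * (nup + 1 / lambda1 ^+ 2)).
Proof.
move=> D QOmega QI L l W w v u.
(* Symmetry is encoded as being Hermitian with sign (-1)^0 and the identity automorphism. *)
case: Omega_corr => /is_hermitianmxP; rewrite expr0 scale1r map_mx_id // => /esym symO psdO _.
have O_ge0 x : 0 <= dot x (Omega *m x) by rewrite /dot mulmxA; exact: psdO.
have symG : (X^T *m X)^T = X^T *m X by rewrite trmx_mul trmxK.
have [[i LE] L_max] := max_diag_entriesP lambda p_ge1.
have [[j lE] l_min] := min_diag_entriesP lambda p_ge1.
rewrite -/D -/L -/l in LE L_max lE l_min.
have L_gt0 : 0 < L by rewrite LE.
have l_gt0 : 0 < l by rewrite lE.
have symD : D^T = D by rewrite tr_diag_mx.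
have LD : op_le D L.
  move=> x; rewrite sqnorm_diag_mx sqnormE mulr_sumr; apply: ler_sum => k _.
  by rewrite ler_wpM2r ?sqr_ge0 // ler_sqr ?L_max // nnegrE ltW.
have lD x : l ^+ 2 * sqnorm x <= sqnorm (D *m x).
  rewrite sqnorm_diag_mx sqnormE mulr_sumr; apply: ler_sum => k _.
  by rewrite ler_wpM2r ?sqr_ge0 // ler_sqr ?l_min // nnegrE ltW.
have uD : D \in unitmx by apply: unitmx_lower_bound lD; rewrite exprn_gt0.
have [_ W_max] := max_eigenvalueP p_ge1 symO.
have [/eigenvalue_colP-/(_ symO)[y yO y0] w_min] := min_eigenvalueP p_ge1 symO.
rewrite -/W -/w in W_max yO w_min.
have y_gt0 : 0 < sqnorm y by rewrite sqnorm_gt0.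
have w_ge0 : 0 <= w by rewrite -(pmulr_lge0 _ y_gt0) -dotZr -yO.
(* A zero eigenvalue would put [y] in the kernel of the invertible [Omega]. *)
have w_gt0 : 0 < w.
  rewrite lt_neqAle w_ge0 andbT; apply/eqP => w0; case/eqP: y0.
  by rewrite -(mulKmx Omega_unit y) yO -w0 scale0r mulmx0.
have W_gt0 : 0 < W.
  by rewrite -(pmulr_lgt0 _ y_gt0); apply: lt_le_trans (W_max y); rewrite yO dotZr mulr_gt0.
have [_ v_max] := max_eigenvalueP p_ge1 symG.
have [/eigenvalue_colP-/(_ symG)[z zG z0] u_min] := min_eigenvalueP p_ge1 symG.
rewrite -/u -/v in v_max zG u_min.
have z_gt0 : 0 < sqnorm z by rewrite sqnorm_gt0.
have u_ge0 : 0 <= u.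
  by rewrite -(pmulr_lge0 _ z_gt0) -dotZr -zG -sqnorm_mulmx sqnorm_ge0.
have v_ge0 : 0 <= v.
  by rewrite -(pmulr_lge0 _ z_gt0); apply: le_trans (v_max z); rewrite -sqnorm_mulmx sqnorm_ge0.
have OwW x : w * sqnorm x <= dot x (Omega *m x) <= W * sqnorm x.
  by rewrite w_min W_max.
(* For the correlation matrix I both eigenvalue bounds are 1, so the same form bounds apply to
   [QI]. *)
have IwW (x : 'cV[R]_p) : 1 * sqnorm x <= dot x (1%:M *m x) <= 1 * sqnorm x.
  by rewrite mul1mx mul1r lexx.
have Xuv x : u * sqnorm x <= dot x (X^T *m X *m x) <= v * sqnorm x.
  by rewrite u_min v_max.
have QO_form := Qcorr_form_bounds l_gt0 L_gt0 w_gt0 W_gt0 symO symD lD LD OwW Xuv.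
have QI_form := Qcorr_form_bounds l_gt0 L_gt0 ltr01 ltr01 (trmx1 _ _) symD lD LD IwW Xuv.
have symQO : QOmega^T = QOmega by exact: Qcorr_tr.
have symQI : QI^T = QI by rewrite /QI -Qcorr1 Qcorr_tr ?trmx1.
rewrite Qcorr1 !mulr1 -/QI -/QOmega in QO_form QI_form.
set cO := u + _ in QO_form *; set cI := u + _ in QI_form *.
set CO := v + _ in QO_form *; set CI := v + _ in QI_form *.
(* [u] can be 0, for instance when n < p; strict positivity comes from the scale term. *)
have cO_gt0 : 0 < cO by rewrite ltr_wpDl // div1r invr_gt0 mulr_gt0 // exprn_gt0.
have cI_gt0 : 0 < cI by rewrite ltr_wpDl // div1r invr_gt0 exprn_gt0.
have CO_gt0 : 0 < CO by rewrite ltr_wpDl // div1r invr_gt0 mulr_gt0 // exprn_gt0.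
have CI_gt0 : 0 < CI by rewrite ltr_wpDl // div1r invr_gt0 exprn_gt0.
have QO_le : op_le QOmega CO.
  apply: psd_op_le => // [|x|x]; [exact: ltW| |by case/andP: (QO_form x)].
  by case/andP: (QO_form x) => + _; apply: le_trans; rewrite mulr_ge0 ?sqnorm_ge0 ?ltW.
have QI_le : op_le QI CI.
  apply: psd_op_le => // [|x|x]; [exact: ltW| |by case/andP: (QI_form x)].
  by case/andP: (QI_form x) => + _; apply: le_trans; rewrite mulr_ge0 ?sqnorm_ge0 ?ltW.
have [uQO QOV_le] : QOmega \in unitmx /\ op_le (invmx QOmega) cO^-1.
  by apply: coercive_op_le_invmx => // x; case/andP: (QO_form x).
have [uQI QIV_le] : QI \in unitmx /\ op_le (invmx QI) cI^-1.
  by apply: coercive_op_le_invmx => // x; case/andP: (QI_form x).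
have [E_ge0 E_le E_min] := spectral_normP (invmx Omega - 1%:M) p_ge1.
have [F_ge0 F_le F_min] := spectral_normP (invmx QOmega - invmx QI) p_ge1.
have DV_le : op_le (invmx D) l^-1 by exact: op_le_invmx.
have FE : invmx QOmega - invmx QI =
    - (invmx QOmega *m (invmx D *m (invmx Omega - 1%:M) *m invmx D) *m invmx QI).
  by rewrite -(Qcorr_sub_Qind X) invmx_sub.
have EF : invmx Omega - 1%:M =
    - (D *m (QOmega *m (invmx QOmega - invmx QI) *m QI) *m D).
  rewrite FE mulmxN mulNmx mulmxN mulNmx opprK -!mulmxA.
  by rewrite (mulKVmx uQO) (mulKVmx uD) (mulKmx uQI) (mulVmx uD) mulmx1.
split.
  rewrite ler_pdivrMr; last by rewrite !mulr_gt0 // exprn_gt0.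
  (* The factors are arranged in the order of the matrix product in [EF], one constant per
     matrix. *)
  have -> : spectral_norm (invmx QOmega - invmx QI) * (L ^+ 2 * CO * CI) =
      L * (CO * spectral_norm (invmx QOmega - invmx QI) * CI) * L by ring.
  apply: E_min; first by rewrite !mulr_ge0 // ltW.
  rewrite EF; apply: op_leN; do 2![apply: op_le_mulmx => //].
  by do 2![apply: op_le_mulmx => //].
(* The same arrangement, following the product in [FE]. *)
have -> : spectral_norm (invmx Omega - 1%:M) / (l ^+ 2 * cO * cI) =
    cO^-1 * (l^-1 * spectral_norm (invmx Omega - 1%:M) * l^-1) * cI^-1.
  by field; rewrite !gt_eqF.
apply: F_min; first by rewrite !mulr_ge0 // invr_ge0 ltW.
rewrite FE; apply: op_leN; do 2![apply: op_le_mulmx => //].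
by do 2![apply: op_le_mulmx => //].
Qed.
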